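(* Let $X$ and $Y$ be metric spaces and let $f:X\to Y$ be a map. Then $f$ is not $F\cup LC_1\cup O$-measurable if and only if there exists a point $x\in X$ such that $f$ is not $F\cup LC_1\cup O$-measurable at $x$.
   Context: A subset of $X$ is an $LC_1$ set if it is the intersection of an open and a closed subset of $X$; it is an $F\cup LC_1\cup O$ set if it is the union of a closed set, an $LC_1$ set and an open set. The map $f$ (not assumed continuous) is not $F\cup LC_1\cup O$-measurable if there is an open set $U\subseteq Y$ such that $f^{-1}(U)$ is not an $F\cup LC_1\cup O$ set in $X$. Let $D_0=\{0\}\subset\mathbb{R}$ and, for $k\ge 1$, let $D_k=\{2^{-n_1}+\dots+2^{-n_k} : n_1<n_2<\dots<n_k,\ n_i\in\mathbb{N}^+\}$. Let $S_4=D_0\cup D_1\cup D_2\cup D_3\cup D_4$, a compact subspace of $\mathbb{R}$. For $x\in X$, a set $S_4(x)\subseteq X$ is the image of $S_4$ under some homeomorphism $h$ of $S_4$ onto a subspace of $X$ with $h(0)=x$; write $D_j(x)=h(D_j)$, so $S_4(x)=D_0(x)\cup D_1(x)\cup\dots\cup D_4(x)$. The map $f$ is not $F\cup LC_1\cup O$-measurable at $x$ if there exist an open set $U\subseteq Y$ and such a set $S_4(x)$ with $f^{-1}(U)\cap S_4(x)=D_1(x)\cup D_3(x)$. *)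

(* Defs.v *)
From HB Require Import structures.
From mathcomp Require Import all_boot all_order all_algebra.
From mathcomp Require Import all_classical reals topology normedtype.

Set Implicit Arguments.
Unset Strict Implicit.
Unset Printing Implicit Defensive.

Import Order.TTheory GRing.Theory Num.Theory.
Import numFieldNormedType.Exports.

Local Open Scope classical_set_scope.
Local Open Scope ring_scope.

Definition LC1 (T : topologicalType) (A : set T) : Prop :=
  exists G H : set T, [/\ open G, closed H & A = G `&` H].

Definition FLC1O (T : topologicalType) (A : set T) : Prop :=
  exists F L O : set T, [/\ closed F, LC1 L, open O & A = F `|` L `|` O].

Definition not_FLC1O_measurable (X Y : topologicalType) (f : X -> Y) : Prop :=
  exists U : set Y, open U /\ ~ FLC1O (f @^-1` U).

(* The homeomorphisms of the subspace A onto the subspace B. Maps between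
   subspaces are total functions, whose values outside of A and B do not
   matter. *)
Definition homeomorphism_onto (T U : topologicalType) (A : set T) (B : set U)
    (h : T -> U) : Prop :=
  [/\ set_bij A B h, {within A, continuous h} &
      exists g : U -> T, {in A, cancel h g} /\ {within B, continuous g}].

Section dyadic_sums.
Variable R : realType.

(* For k = 0 the sum is empty; see dyadic_sums0. *)
Definition dyadic_sums (k : nat) : set R :=
  [set x | exists n : 'I_k -> nat,
    [/\ forall i, (0 < n i)%N,
        forall i j : 'I_k, (i < j)%N -> (n i < n j)%N &
        x = \sum_(i < k) 2 ^- n i]].

Lemma dyadic_sums0 : dyadic_sums 0 = [set 0].
Proof.
apply/seteqP; split=> [x [n [_ _ ->]]|x ->]; first by rewrite big_ord0.
by exists (fun=> 1%N); split=> [//|[]//|]; rewrite big_ord0.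
Qed.

Definition S4 : set R :=
  dyadic_sums 0 `|` dyadic_sums 1 `|` dyadic_sums 2 `|` dyadic_sums 3
    `|` dyadic_sums 4.

End dyadic_sums.

(* D_j(x) is h @` dyadic_sums j, and S_4(x) is h @` S4. *)
Definition not_FLC1O_measurable_at (R : realType) (X Y : metricType R)
    (f : X -> Y) (x : X) : Prop :=
  exists (U : set Y) (h : R -> X),
    [/\ open U,
        homeomorphism_onto (@S4 R) (h @` @S4 R) h,
        h 0 = x &
        f @^-1` U `&` (h @` @S4 R) =
          h @` @dyadic_sums R 1 `|` h @` @dyadic_sums R 3].

(* Main.v *)
Require Import Defs.
From mathcomp Require Import all_boot all_order all_algebra.
From mathcomp Require Import all_classical reals topology normedtype.
From mathcomp Require Import ring lra zify.

Set Implicit Arguments.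
Unset Strict Implicit.
Unset Printing Implicit Defensive.

Import Order.TTheory GRing.Theory Num.Theory.
Import numFieldNormedType.Exports.

Local Open Scope classical_set_scope.
Local Open Scope ring_scope.

(** Both directions compare the preimage [A] of an open set of [Y] with its
    residues: the residue of order [0] is the complement of [A], and the
    residue of order [k.+1] consists of the points of [A] (for [k] even) or
    outside of [A] (for [k] odd) that are limits of points of the residue of
    order [k].  In any topological space, [A] is the union of a closed set, an
    LC_1 set and an open set if and only if its residue of order [4] is empty
    ([FLC1O_residue4]); so a point of that residue is exactly a point outside
    of [A] that is a limit of points of [A], each of which is a limit of
    points outside of [A], and so on for four steps.

    The space [S4] has the same shape.  Its points are the sums [dyadic s] for
    [s] an increasing sequence of at most four positive integers, and
    [dyadic s] is the limit of [dyadic (rcons s n)] as [n] grows.  Hence, if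
    [h] embeds [S4] so that exactly the points of odd level fall in [A], then
    [h 0] is in the residue of order [4] ([limit_tree_residue], [S4_limit]).

    Conversely, starting from a point of the residue of order [4] of [A], one
    chooses at each point [p s] of level less than four a sequence of points
    [p (rcons s n)] of the residue of the next lower order, converging to
    [p s] at least geometrically, and confines all the descendants of
    [p (rcons s n)] to a ball whose radius is a quarter of its distance to
    [p s] ([residue_tree]).  Then [p s] and [p t] are close if and only if [s]
    and [t] have the same entries up to a large bound, which is also the case
    for [dyadic s] and [dyadic t] ([dyadic_embedding]).  So the map sending
    [dyadic s] to [p s] is a homeomorphism of [S4] onto its image
    ([tree_homeomorphism]), and its points of odd level are those in [A]. *)

(** * Residues of a set *)

Section residues.
Variable T : topologicalType.
Implicit Types (A G : set T) (k : nat).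

Definition side A k : set T := if odd k then A else ~` A.

Fixpoint residue A k : set T :=
  if k is k'.+1 then side A k `&` closure (residue A k') else ~` A.

Lemma residue_side A k x : residue A k x -> side A k x.
Proof. by case: k => [|k] //= []. Qed.

Lemma open_meets_closure A G x : closure A x -> open G -> G x ->
  exists y, A y /\ G y.
Proof. by move=> clA oG Gx; apply: clA; apply: open_nbhs_nbhs. Qed.

(** If the residue of order [4] is empty, then [A] is the union of the closure
    of its residue of order [3], of the difference of the closures of its
    residues of orders [1] and [2], and of its interior.  In the other
    direction, points of residues of odd order are not in the open part; a
    point [x] of order [4] is not in the closed part, and the points [y], [z]
    and [w] of orders [3], [2] and [1] can be taken near [x], also outside of
    it.  So [y] and [w] are in the LC_1 part [G `&` H], hence [z], close to
    [y] and a limit of such [w], is in [G] and in [H], although [z] is not in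
    [A]. *)
Lemma FLC1O_residue4 A : FLC1O A <-> residue A 4 = set0.
Proof.
split.
- move=> [F [_ [O [cF [G [H [oG cH ->]]] oO eA]]]].
  have inA y : A y <-> F y \/ (G y /\ H y) \/ O y.
    by rewrite {1}eA /=; split; tauto.
  apply/seteqP; split=> // x -[/= nAx clx].
  have nFx : (~` F) x by move=> Fx; apply/nAx/inA; left.
  have [y [[/= Ay cly] nFy]] :=
    open_meets_closure clx (closed_openC cF) nFx.
  have nOy : ~ O y.
    move=> Oy; have [z [[/= nAz _] Oz]] := open_meets_closure cly oO Oy.
    by apply/nAz/inA; right; right.
  have [Gy Hy] : G y /\ H y by move/inA: Ay => [|[]] //.
  have [z [[/= nAz clz] [nFz Gz]]] := open_meets_closure cly
    (openI (closed_openC cF) oG) (conj nFy Gy).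
  have nHz : (~` H) z by move=> Hz; apply/nAz/inA; right; left.
  have [w [[/= Aw clw] [nFw nHw]]] := open_meets_closure clz
    (openI (closed_openC cF) (closed_openC cH)) (conj nFz nHz).
  have Ow : O w by move/inA: Aw => [|[[]|]] //.
  have [u [nAu Ou]] := open_meets_closure clw oO Ow.
  by apply/nAu/inA; right; right.
- move=> Q4.
  exists (closure (residue A 3)),
    (closure (residue A 1) `&` ~` closure (residue A 2)), (~` closure (~` A)).
  split.
  + exact: closed_closure.
  + exists (~` closure (residue A 2)), (closure (residue A 1)); split.
    * exact: (closed_openC (@closed_closure _ _)).
    * exact: closed_closure.
    * by rewrite setIC.
  + exact: (closed_openC (@closed_closure _ _)).
  + apply/seteqP; split=> [x Ax|x [[clx|[clx nclx]]|nclx]].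
    * have [cl0|] := pselect (closure (~` A) x); last by right.
      left; have [cl2|] := pselect (closure (residue A 2) x).
        by left; apply: subset_closure.
      by right; split=> //; apply: subset_closure.
    * apply: contrapT => nAx.
      by have : residue A 4 x by []; rewrite Q4.
    * by apply: contrapT => nAx; apply: nclx; apply: subset_closure.
    * by apply: contrapT => nAx; apply: nclx; apply: subset_closure.
Qed.

End residues.

(** * Trees of points indexed by finite sequences *)

(** On increasing sequences this says that [s] and [t] have the same entries
    among those that are at most [N].  These relations generate the
    uniform structure for which the extensions of [s] by a large integer
    are close to [s]. *)
Fixpoint agree (N : nat) (s t : seq nat) : bool :=
  match s, t with
  | [::], [::] => true
  | n :: _, [::] => (N < n)%N
  | [::], m :: _ => (N < m)%N
  | n :: s', m :: t' => (n == m) && agree N s' t' || (N < n)%N && (N < m)%N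
  end.

Lemma agree_leq M N s t : (M <= N)%N -> agree N s t -> agree M s t.
Proof.
move=> MN; elim: s t => [|n s IH] [|m t] //=; try exact: leq_ltn_trans.
move=> /orP[/andP[-> /IH ->]//|/andP[Nn Nm]].
by rewrite (leq_ltn_trans MN Nn) (leq_ltn_trans MN Nm) orbT.
Qed.

Lemma agree_rcons N s n : (N < n)%N -> agree N s (rcons s n).
Proof. by move=> Nn; elim: s => //= m s ->; rewrite eqxx. Qed.

Lemma agree_eq s t : (forall N, agree N s t) -> s = t.
Proof.
elim: s t => [|n s IH] [|m t] //= h.
- by have := h m; rewrite ltnn.
- by have := h n; rewrite ltnn.
- have /andP[/eqP -> _] : (n == m) && agree n s t.
    by have := h n; rewrite ltnn orbF.
  congr cons; apply: IH => N.
  have := h (maxn N n); rewrite [(maxn N n < n)%N]ltnNge leq_maxr orbF.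
  by move=> /andP[_]; apply: agree_leq; exact: leq_maxl.
Qed.

(** A uniform embedding of [D], for the uniform structure given by [agree]. *)
Definition tree_embedding (R : realType) (M : pseudoMetricType R)
    (D : set (seq nat)) (p : seq nat -> M) : Prop :=
  (forall e : R, 0 < e -> exists N, forall s t, D s -> D t ->
     agree N s t -> ball (p s) e (p t)) /\
  (forall N, exists2 d : R, 0 < d & forall s t, D s -> D t ->
     ball (p s) d (p t) -> agree N s t).

Lemma tree_embeddingS (R : realType) (M : pseudoMetricType R)
    (D E : set (seq nat)) (p : seq nat -> M) :
  E `<=` D -> tree_embedding D p -> tree_embedding E p.
Proof.
move=> ED [pc pi]; split=> [e /pc[N h]|N].
- by exists N => s t Es Et; apply: h; apply: ED.
- have [d d0 h] := pi N.
  by exists d => // s t Es Et; apply: h; apply: ED.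
Qed.

Lemma tree_embedding_inj (R : realType) (M : pseudoMetricType R)
    (D : set (seq nat)) (p : seq nat -> M) s t :
  tree_embedding D p -> D s -> D t -> p s = p t -> s = t.
Proof.
move=> [_ pi] Ds Dt pst; apply: agree_eq => N.
by have [d d0] := pi N; apply=> //; rewrite pst; apply: ballxx.
Qed.

(** Closeness in [M] gives agreement of the indices, which gives closeness in
    [M']. *)
Lemma tree_embedding_transfer (R : realType) (M M' : pseudoMetricType R)
    (D : set (seq nat)) (p : seq nat -> M) (q : seq nat -> M') (h : M -> M') :
  tree_embedding D p -> tree_embedding D q ->
  (forall s, D s -> h (p s) = q s) -> {within p @` D, continuous h}.
Proof.
move=> [_ pi] [qc _] hpq; apply/subspace_continuousP => _ [s Ds <-].
apply/cvg_ballP => e /qc[N qN].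
have [d d0 pd] := pi N.
apply: filterS (nbhsx_ballx (p s) d d0) => y psy [t Dt pt].
move: psy; rewrite -pt => psy.
have : ball (h (p s)) e (h (p t)); last by [].
rewrite !hpq //; exact: qN (pd _ _ _ _ _).
Qed.

Lemma tree_embedding_lift (R : realType) (M : pseudoMetricType R) (V : Type)
    (D : set (seq nat)) (p : seq nat -> M) (q : seq nat -> V) :
  tree_embedding D p -> exists h : M -> V, forall s, D s -> h (p s) = q s.
Proof.
move=> pE.
have /choice[c cP] : forall x, exists s, (p @` D) x -> D s /\ p s = x.
  move=> x; have [[s Ds ps]|nx] := pselect ((p @` D) x).
    by exists s.
  by exists [::].
exists (q \o c) => s Ds /=.
have [Dc pc] := cP (p s) (ex_intro2 _ _ s Ds erefl).
by rewrite (tree_embedding_inj pE Dc Ds pc).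
Qed.

Lemma tree_homeomorphism (R : realType) (M M' : pseudoMetricType R)
    (D : set (seq nat)) (p : seq nat -> M) (q : seq nat -> M') :
  tree_embedding D p -> tree_embedding D q ->
  exists h : M -> M', (forall s, D s -> h (p s) = q s) /\
    homeomorphism_onto (p @` D) (h @` (p @` D)) h.
Proof.
move=> pE qE.
have [h hpq] := tree_embedding_lift q pE.
have [g gqp] := tree_embedding_lift p qE.
exists h; split=> //.
have hE : h @` (p @` D) = q @` D.
  by rewrite image_comp; apply: eq_imagel => s Ds; exact: hpq.
split.
- split=> [y py||//]; first by exists y.
  move=> _ _ /set_mem[s Ds <-] /set_mem[t Dt <-]; rewrite !hpq // => qst.
  by rewrite (tree_embedding_inj qE Ds Dt qst).
- exact: tree_embedding_transfer hpq.
- exists g; split; last by rewrite hE; exact: tree_embedding_transfer gqp.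
  by move=> _ /set_mem[s Ds <-]; rewrite hpq // gqp.
Qed.

(** * Trees of residual points in a metric space *)

Lemma halving_null (R : realType) (u : nat -> R) :
  (forall n, 0 <= u n) -> (forall n, u n.+1 <= u n / 2) ->
  forall e : R, 0 < e -> exists N, forall n, (N <= n)%N -> u n < e.
Proof.
move=> u0 uS e e0.
(* A bound by u 0 / n.+1 is enough, since (n + 2) / 2 <= n + 1. *)
have bound n : u n * n.+1%:R <= u 0%N.
  elim: n => [|n IH]; first by rewrite mulr1.
  have := ler_wpM2r (ler0n R n.+2) (uS n).
  rewrite (mulrSr _ n.+1) in IH *.
  have n0 := ler0n R n.
  move: (u0 n) IH n0; rewrite !(mulrSr _ n).
  by nra.
have [N uN] : exists N, u 0%N < e * N%:R.
  exists (Num.bound (u 0%N / e)); rewrite mulrC -ltr_pdivrMr //.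
  by rewrite archi_boundP // divr_ge0 // ltW.
exists N => n Nn; rewrite -(ltr_pM2r (ltr0Sn R n)).
apply: (le_lt_trans (bound n)); apply: (lt_le_trans uN).
by rewrite ler_pM2l // ler_nat leqW.
Qed.

Lemma finite_lower_bound (R : realType) (u : nat -> R) N :
  (forall n, 0 < u n) ->
  exists2 d : R, 0 < d & forall n, (n <= N)%N -> d <= u n.
Proof.
move=> u0; elim: N => [|N [d d0 dP]].
  by exists (u 0%N) => // n; rewrite leqn0 => /eqP ->.
exists (Num.min d (u N.+1)); first by rewrite lt_min d0 u0.
move=> n; rewrite leq_eqVlt ltnS => /orP[/eqP ->|/dP h].
  by rewrite ge_min lexx orbT.
by rewrite ge_min h.
Qed.

Lemma finite_upper_bound (u : nat -> nat) N :
  exists M, forall n, (n <= N)%N -> (u n <= M)%N.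
Proof.
exists (\max_(n < N.+1) u n) => n nN.
exact: (@leq_bigmax _ (fun i : 'I_N.+1 => u i) (Ordinal (nN : (n < N.+1)%N))).
Qed.

Section trees_in_metric_spaces.
Variables (R : realType) (X : metricType R).

Lemma closure_mdist (B : set X) x (e : R) : closure B x -> 0 < e ->
  exists y, B y /\ mdist x y < e.
Proof.
move=> clB e0; have [y [By xy]] := clB _ (nbhsx_ballx x e e0).
by exists y; split=> //; move: xy; rewrite ballEmdist.
Qed.

(** The points approximating [x] differ from [x] because consecutive residues
    lie on opposite sides of [A]. *)
Lemma residue_children (A : set X) k x (r : R) : 0 < r ->
  residue A k.+1 x ->
  exists y : nat -> X, [/\ forall n, residue A k (y n),
    forall n, 0 < mdist x (y n), mdist x (y 0%N) <= r &
    forall n, mdist x (y n.+1) <= mdist x (y n) / 4].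
Proof.
move=> r0 [Ax clx].
have /choice[c cP] : forall e : R, exists y,
    0 < e -> [/\ residue A k y, 0 < mdist x y & mdist x y < e].
  move=> e; have [e0|] := ltP 0 e; last by exists x.
  have [y [Ay xy]] := closure_mdist clx e0.
  exists y => _; split=> //; rewrite mdist_gt0; apply/eqP => exy.
  move: Ax (residue_side Ay); rewrite exy /side /=.
  by case: (odd k).
pose y := fix y n := if n is n'.+1 then c (mdist x (y n') / 4) else c r.
have y0 n : 0 < mdist x (y n).
  elim: n => [|n IH] /=; first by have [] := cP _ r0.
  by have [] := cP (mdist x (y n) / 4) (divr_gt0 IH (ltr0Sn _ _)).
exists y; split=> // [n||n].
- case: n => [|n] /=; first by have [] := cP _ r0.
  by have [] := cP (mdist x (y n) / 4) (divr_gt0 (y0 n) (ltr0Sn _ _)).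
- by have [_ _ /ltW] := cP _ r0.
- by have [_ _ /ltW] := cP (mdist x (y n) / 4) (divr_gt0 (y0 n) (ltr0Sn _ _)).
Qed.

(** The tree with root [x] whose subtrees are the trees [p n] with roots
    [y n]. *)
Section graft.
Variables (x : X) (y : nat -> X) (p : nat -> seq nat -> X) (k : nat).
Hypothesis y_gt0 : forall n, 0 < mdist x (y n).
Hypothesis yS : forall n, mdist x (y n.+1) <= mdist x (y n) / 4.
Hypothesis p_close : forall n s, (size s <= k)%N ->
  mdist (y n) (p n s) <= mdist x (y n) / 4.
Hypothesis p_emb :
  forall n, tree_embedding [set s | (size s <= k)%N] (p n).

Definition graft (s : seq nat) : X := if s is n :: s' then p n s' else x.

Let y_nonincr m n : (m <= n)%N -> mdist x (y n) <= mdist x (y m).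
Proof.
elim: n => [|n IH]; first by rewrite leqn0 => /eqP ->.
rewrite leq_eqVlt ltnS => /orP[/eqP -> //|/IH mn].
by have := yS n; have := y_gt0 n; lra.
Qed.

Let y_lt m n : (m < n)%N -> mdist x (y n) <= mdist x (y m) / 4.
Proof.
case: n => // n mn; apply: (le_trans (yS n)); rewrite ltnS in mn.
by have := y_nonincr mn; lra.
Qed.

Lemma graft_near n s : (size s <= k)%N ->
  mdist x (graft (n :: s)) <= 5 / 4 * mdist x (y n).
Proof.
move=> /(p_close n) /=.
by have := metric_triangle x (y n) (p n s); lra.
Qed.

Lemma graft_far n s : (size s <= k)%N ->
  3 / 4 * mdist x (y n) <= mdist x (graft (n :: s)).
Proof.
move=> /(p_close n) /=.
have := metric_triangle x (p n s) (y n).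
by rewrite (metric_sym (p n s)); lra.
Qed.

(** The subtrees at [y m] and [y n] lie in balls of radius a quarter of the
    distances of [y m] and [y n] to [x], and the second distance is at most a
    quarter of the first: [1 - 1 / 4 - (1 + 1 / 4) / 4 >= 1 / 4]. *)
Let graft_apart m n s t : (size s <= k)%N -> (size t <= k)%N -> (m < n)%N ->
  mdist x (y m) / 4 <= mdist (graft (m :: s)) (graft (n :: t)).
Proof.
move=> /(graft_far m) sk /(graft_near n) tk /y_lt mn.
have := metric_triangle x (graft (n :: t)) (graft (m :: s)).
rewrite (metric_sym (graft (n :: t))).
by have := y_gt0 m; lra.
Qed.

(** All but finitely many subtrees are contained in a given ball around [x],
    and the subtrees with index at most [N] are apart from [x] and from all
    the others; so both halves reduce to finitely many of the embeddings
    [p n]. *)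
Lemma graft_embedding : tree_embedding [set s | (size s <= k.+1)%N] graft.
Proof.
split=> [e e0|N].
- have [N0 yN0] : exists N0, forall n, (N0 <= n)%N -> mdist x (y n) < e / 4.
    apply: halving_null; last by lra.
      by move=> n; exact: mdist_ge0.
    by move=> n; have := yS n; have := y_gt0 n; lra.
  have /choice[N1 N1P] : forall n, exists N, forall s t, (size s <= k)%N ->
      (size t <= k)%N -> agree N s t -> ball (p n s) e (p n t).
    by move=> n; have [pc _] := p_emb n; exact: pc.
  have [N2 N2P] := finite_upper_bound N1 N0.
  have near n s : (size (n :: s) <= k.+1)%N -> (N0 < n)%N ->
      mdist x (graft (n :: s)) < e / 2.
    move=> /= sk /ltnW/yN0 yn.
    by have := graft_near n sk; lra.
  exists (maxn N0 N2) => -[|n s] [|m t] /= sk tk; rewrite ?gtn_max.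
  + by move=> _; exact: ballxx.
  + move=> /andP[N0m _]; rewrite ballEmdist /=.
    by have := near m t tk N0m; rewrite /=; lra.
  + move=> /andP[N0n _]; apply: ball_sym; rewrite ballEmdist /=.
    by have := near n s sk N0n; rewrite /=; lra.
  + have [nN0|N0n] := leqP n N0.
      rewrite /= orbF => /andP[/eqP <-] st.
      apply: N1P => //; apply: agree_leq st.
      by rewrite (leq_trans (N2P _ nN0)) // leq_maxr.
    move=> h; have N0m : (N0 < m)%N.
      by case/orP: h => [/andP[/eqP <-]|/andP[_ /andP[]]].
    rewrite ballEmdist /=.
    have := near n s sk N0n; have := near m t tk N0m.
    have := metric_triangle (graft (n :: s)) x (graft (m :: t)).
    by rewrite (metric_sym _ x) /=; lra.
- have /choice[d dP] : forall n, exists d : R, 0 < d /\ forall s t,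
      (size s <= k)%N -> (size t <= k)%N -> ball (p n s) d (p n t) ->
      agree N s t.
    by move=> n; have [_ /(_ N)[d d0 h]] := p_emb n; exists d.
  have [d1 d10 d1P] := @finite_lower_bound R d N (fun n => (dP n).1).
  have yN n : (n <= N)%N -> mdist x (y N) <= mdist x (y n) by apply: y_nonincr.
  exists (Num.min d1 (mdist x (y N) / 4)).
    by rewrite lt_min d10 divr_gt0.
  move=> [|n s] [|m t] //= sk tk; rewrite ballEmdist /= lt_min => /andP[h1 h2].
  + rewrite ltnNge; apply/negP => /yN mN.
    by have := graft_far m tk; have := y_gt0 N; rewrite /=; lra.
  + rewrite ltnNge; apply/negP => /yN nN.
    have := graft_far n sk; have := y_gt0 N.
    by rewrite metric_sym /= in h2 *; lra.
  + have [nm|mn|enm] := ltngtP n m.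
    * have [nN|Nn] := leqP n N; last by rewrite (ltn_trans Nn nm).
      by have := graft_apart sk tk nm; have := yN n nN; rewrite /=; lra.
    * have [mN|Nm] := leqP m N; last by rewrite (ltn_trans Nm mn).
      have := graft_apart tk sk mn; have := yN m mN.
      by rewrite (metric_sym (graft (m :: t))) /=; lra.
    * subst m; have [nN|//] := leqP n N; last by rewrite orbT.
      rewrite /= orbF; apply: (dP n).2 => //.
      by rewrite ballEmdist /=; apply: lt_le_trans h1 (d1P _ nN).
Qed.

End graft.

(** The radius is there for the induction, which needs the subtree of a child
    to stay close to that child compared with its distance to [x]. *)
Lemma residue_tree (A : set X) k x (r : R) : 0 < r -> residue A k x ->
  exists p : seq nat -> X, [/\ p [::] = x,
    forall s, (size s <= k)%N -> residue A (k - size s) (p s),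
    forall s, (size s <= k)%N -> mdist x (p s) <= r &
    tree_embedding [set s | (size s <= k)%N] p].
Proof.
elim: k x r => [|k IH] x r r0 Qx.
  exists (fun=> x); split=> // [s _|].
    by rewrite mdistxx ltW.
  split=> [e e0|N]; first by exists 0%N => s t _ _ _; exact: ballxx.
  by exists 1 => //= -[|//] [|//].
have r20 : 0 < r / 2 by lra.
have [y [Qy y0 yr yS]] := residue_children r20 Qx.
have /choice[p pP] : forall n, exists p : seq nat -> X, [/\ p [::] = y n,
    forall s, (size s <= k)%N -> residue A (k - size s) (p s),
    forall s, (size s <= k)%N -> mdist (y n) (p s) <= mdist x (y n) / 4 &
    tree_embedding [set s | (size s <= k)%N] p].
  by move=> n; apply: IH => //; have := y0 n; lra.
have pclose n s : (size s <= k)%N -> mdist (y n) (p n s) <= mdist x (y n) / 4.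
  by have [_ _ h _] := pP n; exact: h.
exists (graft x p); split=> //.
- by case=> [|n s] //= sk; have [_ h _ _] := pP n; exact: h.
- case=> [_|n s sk]; first by rewrite mdistxx ltW.
  have := graft_near pclose n sk.
  suff : mdist x (y n) <= r / 2 by lra.
  by elim: n {sk} => // n IHn; have := yS n; have := y0 n; lra.
- by apply: (graft_embedding y0 yS pclose) => n; have [] := pP n.
Qed.

End trees_in_metric_spaces.

(** * The space S4 as a tree *)

Section dyadic_tree.
Variable R : realType.
Implicit Types s t : seq nat.

Definition dyadic s : R := \sum_(n <- s) 2 ^- n.

Lemma dyadic_cons n s : dyadic (n :: s) = 2 ^- n + dyadic s.
Proof. by rewrite /dyadic big_cons. Qed.

Lemma dyadic_nil : dyadic [::] = 0. Proof. by rewrite /dyadic big_nil. Qed.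

(** The indices start from [1], hence the path from [0]. *)
Definition increasing k : set (seq nat) :=
  [set s | path ltn 0 s /\ (size s <= k)%N].

Lemma dyadic_sumsE k :
  @dyadic_sums R k = dyadic @` [set s | path ltn 0 s /\ size s = k].
Proof.
apply/seteqP; split=> x /=.
- move=> [n [n0 nlt ->]]; exists [seq n i | i <- enum 'I_k].
    rewrite size_map size_enum_ord; split=> //.
    rewrite path_sortedE; last by move=> ? ? ?; exact: ltn_trans.
    apply/andP; split; first by apply/allP => _ /mapP[i _ ->]; exact: n0.
    rewrite sorted_map.
    have : sorted ltn (map val (enum 'I_k)).
      by rewrite val_enum_ord iota_ltn_sorted.
    by rewrite sorted_map; apply: sub_sorted => i j; exact: nlt.
  by rewrite /dyadic big_map big_enum.
- move=> [s [ps <-] <-].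
  have sE := ps.
  rewrite path_sortedE in sE; last by move=> ? ? ?; exact: ltn_trans.
  have /andP[s0 slt] := sE.
  exists (fun i : 'I_(size s) => nth 0%N s i); split=> [i|i j ij|].
  + exact: (all_nthP 0%N s0).
  + by apply: (sorted_ltn_nth ltn_trans 0%N slt); rewrite ?inE.
  + by rewrite /dyadic (big_nth 0%N) big_mkord.
Qed.

Lemma pow2_gt0 (n : nat) : 0 < 2 ^- n :> R.
Proof. by rewrite invr_gt0 exprn_gt0. Qed.

Lemma pow2_le (m n : nat) : (m <= n)%N -> 2 ^- n <= 2 ^- m :> R.
Proof.
by move=> mn; rewrite lef_pV2 ?posrE ?exprn_gt0 // ler_weXn2l ?ler1n.
Qed.

Lemma pow2_lt (m n : nat) : (m < n)%N -> 2 ^- n <= 2 ^- m / 2 :> R.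
Proof.
by move=> /pow2_le; rewrite exprSr invfM mulrC.
Qed.

Lemma pow2_le1 (n : nat) : 2 ^- n <= 1 :> R.
Proof. by rewrite invf_le1 ?exprn_gt0 // exprn_ege1 ?ler1n. Qed.

Lemma dyadic_ge0 s : 0 <= dyadic s.
Proof. by apply: sumr_ge0 => n _; exact: ltW (pow2_gt0 _). Qed.

(** The sum is at most [2 ^- n + 2 ^- n.+1 + ... + 2 ^- (n + size s)], by
    induction because [2 ^- m * (2 - c)] increases with [2 ^- m]. *)
Lemma dyadic_upper n s : path ltn n s ->
  dyadic (n :: s) + 2 ^- (n + size s) <= 2 * 2 ^- n.
Proof.
elim: s n => [|m s IH] n.
  by rewrite dyadic_cons dyadic_nil addn0 addr0 mulr_natl mulr2n.
move=> /= /andP[nm /IH]; rewrite (dyadic_cons n).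
rewrite !exprD !invfM (exprS _ (size s)) invfM.
have mn := pow2_lt nm; have s1 := pow2_le1 (size s).
have : 2 ^- m * (2 - 2 ^- size s) <= 2 ^- n / 2 * (2 - 2 ^- size s) :> R.
  by rewrite ler_wpM2r //; lra.
by lra.
Qed.

Lemma dyadic_agree N m n s t : path ltn m s -> path ltn n t ->
  agree N s t -> `|dyadic s - dyadic t| <= 2 ^- N.
Proof.
have small k u : path ltn k u -> (N < k)%N -> dyadic (k :: u) <= 2 ^- N.
  move=> /dyadic_upper ku /pow2_lt Nk.
  by have := pow2_gt0 (k + size u); lra.
elim: s m n t => [|i s IH] m n [|j t] /=; rewrite ?dyadic_nil.
- by rewrite subrr normr0 ltW ?pow2_gt0.
- move=> _ /andP[_ jt] /(small _ _ jt).
  by rewrite sub0r normrN ger0_norm // dyadic_ge0.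
- move=> /andP[_ si] _ /(small _ _ si).
  by rewrite subr0 ger0_norm // dyadic_ge0.
- move=> /andP[_ si] /andP[_ tj] /orP[/andP[/eqP ij st]|/andP[Ni Nj]].
    rewrite -ij in tj *; rewrite !dyadic_cons.
    rewrite [X in `|X|](_ : _ = dyadic s - dyadic t); last by ring.
    exact: IH si tj st.
  have := small _ _ si Ni; have := small _ _ tj Nj.
  have := dyadic_ge0 (i :: s); have := dyadic_ge0 (j :: t).
  by rewrite ler_norml; lra.
Qed.

(** With [a = 2 ^- i] and [c = 2 ^- size t], the second sum is at most
    [2 ^- j * (2 - c) <= a / 2 * (2 - c) = a - a * c / 2], and [c / 2] is at
    least [2 ^- k]. *)
Lemma dyadic_gap k i j s t : (size t < k)%N -> path ltn j t -> (i < j)%N ->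
  2 ^- (i + k) <= dyadic (i :: s) - dyadic (j :: t).
Proof.
move=> tk /dyadic_upper jt /pow2_lt ij.
have s0 := dyadic_ge0 s; have c1 := pow2_le1 (size t).
rewrite exprD invfM in jt; rewrite dyadic_cons exprD invfM.
have : 2 ^- i * 2 ^- k <= 2 ^- i * (2 ^- size t / 2) :> R.
  by rewrite ler_pM2l ?pow2_gt0 // pow2_lt.
have : 2 ^- j * (2 - 2 ^- size t) <= 2 ^- i / 2 * (2 - 2 ^- size t) :> R.
  by rewrite ler_wpM2r //; lra.
by lra.
Qed.

(** The lower bound has to depend on the length [k]: with arbitrarily long
    sequences, [2 ^- n] would be a limit of sums starting with
    [2 ^- n.+1]. *)
Lemma dyadic_disagree N k m n s t : path ltn m s -> path ltn n t ->
  (size s <= k)%N -> (size t <= k)%N -> ~~ agree N s t ->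
  2 ^- (N + k) <= `|dyadic s - dyadic t|.
Proof.
have lower i u : (i <= N)%N -> 2 ^- (N + k) <= `|dyadic (i :: u)|.
  move=> iN; rewrite ger0_norm ?dyadic_ge0 // dyadic_cons.
  by have := dyadic_ge0 u; have := pow2_le (leq_trans iN (leq_addr k N)); lra.
have gap i j u v : (size v < k)%N -> path ltn j v -> (i < j)%N ->
    (i <= N)%N -> 2 ^- (N + k) <= dyadic (i :: u) - dyadic (j :: v).
  move=> vk jv ij iN; apply: le_trans (dyadic_gap u vk jv ij).
  by apply: pow2_le; rewrite leq_add2r.
elim: s m n t => [|i s IH] m n [|j t] //=.
- by move=> _ _ _ _; rewrite -leqNgt dyadic_nil sub0r normrN; exact: lower.
- by move=> _ _ _ _; rewrite -leqNgt dyadic_nil subr0; exact: lower.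
- move=> /andP[_ si] /andP[_ tj] sk tk; rewrite negb_or !negb_and -!leqNgt.
  have [ij|ji|eij] := ltngtP i j => /=.
  + move=> iN; have {}iN : (i <= N)%N by lia.
    by rewrite ler_normr gap.
  + move=> jN; have {}jN : (j <= N)%N by lia.
    by rewrite distrC ler_normr gap.
  + subst j; move=> /andP[st _]; rewrite !dyadic_cons.
    rewrite [X in `|X|](_ : _ = dyadic s - dyadic t); last by ring.
    by apply: (IH i i) => //; exact: ltnW.
Qed.

Lemma increasing_nil k : increasing k [::].
Proof. by []. Qed.

Lemma increasing_rcons k s n : increasing k s -> (size s < k)%N ->
  (last 0%N s < n)%N -> increasing k (rcons s n).
Proof. by move=> [ps _] sk ln; split; rewrite ?size_rcons // rcons_path ps. Qed.

Lemma dyadic_embedding k : tree_embedding (increasing k) dyadic.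
Proof.
split=> [e e0|N].
- have [N NP] : exists N, forall n, (N <= n)%N -> (2 ^- n : R) < e.
    apply: halving_null => // n; first exact: ltW (pow2_gt0 n).
    exact: pow2_lt.
  exists N => s t [ps _] [pt _] st; rewrite -ball_normE /=.
  exact: le_lt_trans (dyadic_agree ps pt st) (NP N (leqnn N)).
- exists (2 ^- (N + k)); first exact: pow2_gt0.
  move=> s t [ps sk] [pt tk]; rewrite -ball_normE /=.
  by apply: contraTT => /(dyadic_disagree ps pt sk tk); rewrite leNgt.
Qed.

Lemma S4E : @S4 R = dyadic @` increasing 4.
Proof.
rewrite /S4 !dyadic_sumsE; apply/seteqP; split=> [x|_ [s [ps s4] <-]].
  by move=> [[[[]|]|]|] [s [ps ss] <-]; exists s => //; split; rewrite ?ss.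
have dyk k : size s = k ->
    (dyadic @` [set t | path ltn 0 t /\ size t = k]) (dyadic s).
  by move=> sk; exists s.
case es : (size s) s4 => [|[|[|[|[|//]]]]] _; have := dyk _ es;
  by rewrite /setU /=; tauto.
Qed.

End dyadic_tree.

(** * Copies of S4 and the residue of order four *)

(** By induction on [j], a point of level [k - j] is in the residue of order
    [j]. *)
Lemma limit_tree_residue (T : topologicalType) (A : set T) k
    (p : seq nat -> T) :
  (forall s, increasing k s -> side A (k - size s) (p s)) ->
  (forall s G, increasing k s -> (size s < k)%N -> open G -> G (p s) ->
     exists n, increasing k (rcons s n) /\ G (p (rcons s n))) ->
  residue A k (p [::]).
Proof.
move=> pA pG.
suff main j s : increasing k s -> (size s + j = k)%N -> residue A j (p s).
  exact: main (increasing_nil k) (add0n k).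
elim: j s => [|j IH] s ks sj.
  by have := pA s ks; rewrite -sj addn0 subnn.
split; first by have := pA s ks; rewrite -sj addKn.
move=> B; rewrite nbhsE => -[G [oG Gs] GB].
have sk : (size s < k)%N by rewrite -sj -addn1 leq_add2l.
have [n [kn Gn]] := pG s G ks sk oG Gs.
exists (p (rcons s n)); split; last exact: GB.
by apply: IH => //; rewrite size_rcons addSnnS.
Qed.

Lemma S4_limit (R : realType) (T : topologicalType) (h : R -> T) s (G : set T) :
  {within @S4 R, continuous h} -> increasing 4 s -> (size s < 4)%N ->
  open G -> G (h (dyadic R s)) ->
  exists n, increasing 4 (rcons s n) /\ G (h (dyadic R (rcons s n))).
Proof.
move=> hc s4 ss oG Gs.
have S4s t : increasing 4 t -> @S4 R (dyadic R t) by rewrite S4E; exists t.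
have := ((subspace_continuousP _ _).1 hc) _ (S4s _ s4) G
  (open_nbhs_nbhs (conj oG Gs)).
rewrite /= /nbhs /= /within /= => /nbhs_ballP[e /= e0 He].
have [N HN] := (dyadic_embedding R 4).1 e e0.
exists (maxn N (last 0%N s)).+1.
have sn : increasing 4 (rcons s (maxn N (last 0%N s)).+1).
  by apply: increasing_rcons => //; rewrite ltnS leq_maxr.
split=> //; apply: He; last exact: S4s.
by apply: HN => //; apply: agree_rcons; rewrite ltnS leq_maxl.
Qed.

Theorem mainTheorem8 (R : realType) (X Y : metricType R) (f : X -> Y) :
  not_FLC1O_measurable f <-> exists x : X, not_FLC1O_measurable_at f x.
Proof.
split.
- move=> [U [oU nU]].
  have /set0P[x Qx] : residue (f @^-1` U) 4 != set0.
    by apply/eqP => /FLC1O_residue4.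
  have [p [px pQ _ pE]] := residue_tree ltr01 Qx.
  have {}pE : tree_embedding (increasing 4) p.
    by apply: tree_embeddingS pE => s -[].
  have [h [hp hh]] := tree_homeomorphism (dyadic_embedding R 4) pE.
  exists x, U, h; split=> //; first by rewrite S4E.
    by rewrite -px -hp // dyadic_nil.
  have hS k : (k <= 4)%N -> h @` @dyadic_sums R k =
      p @` [set s | path ltn 0 s /\ size s = k].
    move=> k4; rewrite dyadic_sumsE image_comp; apply: eq_imagel.
    by move=> s [ps sk]; apply: hp; split; rewrite ?sk.
  rewrite !hS // S4E image_comp (eq_imagel hp).
  apply/seteqP; split=> [y [Us [s [ps s4] sE]]|].
    rewrite -sE in Us *.
    have := residue_side (pQ s s4).
    case es : (size s) s4 => [|[|[|[|[|//]]]]] _; rewrite /side /= => hs.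
    + by [].
    + by left; exists s.
    + by [].
    + by right; exists s.
    + by [].
  by move=> _ [|] [s [ps sk] <-]; (split;
    last by exists s; rewrite // /increasing /= sk);
    have := residue_side (pQ s _); rewrite sk; apply.
- move=> [x [U [h [oU [[_ hinj _] hc _] _ hU]]]].
  exists U; split=> // /FLC1O_residue4 Q0.
  have S4s t : increasing 4 t -> @S4 R (dyadic R t) by rewrite S4E; exists t.
  suff : residue (f @^-1` U) 4 (h (dyadic R [::])) by rewrite Q0.
  apply: (limit_tree_residue (p := h \o dyadic R)) => [s s4|s G s4]; last first.
    exact: S4_limit.
  have UE : U (f (h (dyadic R s))) <-> odd (size s).
    split=> [Us|so].
      have : (f @^-1` U `&` h @` @S4 R) (h (dyadic R s)).
        by split=> //; exists (dyadic R s) => //; exact: S4s.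
      rewrite hU !dyadic_sumsE.
      have same t : increasing 4 t -> h (dyadic R t) = h (dyadic R s) -> t = s.
        move=> t4 /hinj; rewrite !inE => /(_ (S4s _ t4) (S4s _ s4)).
        exact: tree_embedding_inj (dyadic_embedding R 4) t4 s4.
      by move=> [|] [_ [t [pt tk] <-]] /same <- //; rewrite /increasing /= ?tk.
    have : (h @` @dyadic_sums R 1 `|` h @` @dyadic_sums R 3) (h (dyadic R s)).
      case: s4 so => ps; case es : (size s) => [|[|[|[|[|//]]]]] // _ _.
        by left; exists (dyadic R s) => //; rewrite dyadic_sumsE; exists s.
      by right; exists (dyadic R s) => //; rewrite dyadic_sumsE; exists s.
    by rewrite -hU => -[].
  rewrite /side /= oddB ?s4.2 //=; case: (odd (size s)) UE => UE.
    exact/UE.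
  by move/UE.
Qed.
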